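(* Let $\Gamma$ be a finite set of formulas of $\mathcal L_J$ and $A\in\mathcal L_J$. (i) If $\Gamma\vdash_{\mathbf{mJ}}A$ then $\mathbf{MS}\vDash\Gamma\Rightarrow A$. (ii) If $\Gamma\vdash_{\mathbf{sCoJ}}A$ then $\mathbf{sCoTS}\vDash\Gamma\Rightarrow A$. (iii) If $\Gamma\vdash_{\mathbf{CoJ}}A$ then $\mathbf{CoTS}\vDash\Gamma\Rightarrow A$. (iv) If $\Gamma\vdash_{\mathbf{J}}A$ then $\mathbf{TS}\vDash\Gamma\Rightarrow A$. (v) If $\Gamma\vdash_{\mathbf{sI}}A$ then $\mathbf{sS}\vDash\Gamma\Rightarrow A$. (vi) If $\Gamma\vdash_{\mathbf{I}}A$ then $\mathbf{S}\vDash\Gamma\Rightarrow A$.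
   Context: $\mathcal L_J$: formulas built from atoms, $\top,\bot$ by $\wedge,\vee,\to$ and a unary operator $J$. Sequents $\Gamma\vdash A$ have $\Gamma$ a finite set of formulas; initial sequents are $A\vdash A$. Rules (premises / conclusion): ($F$) $C\vdash A\ /\ JC\vdash JA$ (exactly one formula on the left). (cut) $\Gamma_0\vdash A$ and $\Gamma_1,A\vdash B\ /\ \Gamma_0,\Gamma_1\vdash B$. ($\top$) $/\ \Gamma\vdash\top$. ($\bot$) $\Gamma\vdash\bot\ /\ \Gamma\vdash A$. ($\vee E$) $\Gamma_0,A\vdash C$ and $\Gamma_1,B\vdash C\ /\ \Gamma_0,\Gamma_1,A\vee B\vdash C$. ($\vee I$) $\Gamma\vdash A_i\ /\ \Gamma\vdash A_0\vee A_1$ ($i=0,1$). ($\wedge E$) $\Gamma\vdash A_0\wedge A_1\ /\ \Gamma\vdash A_i$ ($i=0,1$). ($\wedge I$) $\Gamma_0\vdash A$ and $\Gamma_1\vdash B\ /\ \Gamma_0,\Gamma_1\vdash A\wedge B$. ($\to E$) $\Gamma_0\vdash A$ and $\Gamma_1\vdash J(A\to B)\ /\ \Gamma_0,\Gamma_1\vdash B$. ($\to I$) $JC,A\vdash B\ /\ C\vdash A\to B$ (exactly one formula $C$). Additional rules: ($sCoJ$) $JA\vdash\bot\ /\ A\vdash\bot$; ($CoJ$) $\Gamma\vdash A\ /\ \Gamma\vdash JA$; ($J$) $\Gamma\vdash JA\ /\ \Gamma\vdash A$. Logics: $\mathbf{mJ}$ has all rules except the additional ones; $\mathbf{sCoJ}=\mathbf{mJ}+(sCoJ)$;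 $\mathbf{CoJ}=\mathbf{mJ}+(CoJ)$; $\mathbf J=\mathbf{mJ}+(J)$; $\mathbf{sI}=\mathbf{mJ}+(sCoJ)+(J)$; $\mathbf I=\mathbf{mJ}+(J)+(CoJ)$. A locale $X$ is identified with its frame (complete lattice with finite meets distributing over arbitrary joins). A modal space is a pair $(X,J)$ with $X$ a locale and $J:X\to X$ monotone and preserving all joins; $a\rightarrow_Jb=\bigvee\{d: Jd\wedge a\le b\}$. Classes: $\mathbf{MS}$: all modal spaces; $\mathbf{sCoTS}$: $Ja=0$ implies $a=0$; $\mathbf{TS}$: $Ja\le a$ for all $a$; $\mathbf{CoTS}$: $a\le Ja$ for all $a$; $\mathbf{sS}=\mathbf{sCoTS}\cap\mathbf{TS}$; $\mathbf S=\mathbf{TS}\cap\mathbf{CoTS}$. A topological model is $(X,J,V)$ with $(X,J)$ a modal space and $V:\mathcal L_J\to X$ with $V(\top)=1$, $V(\bot)=0$, $V(A\wedge B)=V(A)\wedge V(B)$, $V(A\vee B)=V(A)\vee V(B)$, $V(A\to B)=V(A)\rightarrow_JV(B)$, $V(JA)=JV(A)$. $\mathcal C\vDash\Gamma\Rightarrow A$ means $\bigwedge_{\gamma\in\Gamma}V(\gamma)\le V(A)$ for every model with $(X,J)\in\mathcal C$. *)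

(* Defs.v *)
From HB Require Import structures.
From mathcomp Require Import all_boot all_order finmap.
From mathcomp Require Import boolp classical_sets.
Set Implicit Arguments.
Unset Strict Implicit.
Unset Printing Implicit Defensive.
Import Order.TTheory.
Local Open Scope order_scope.

Inductive form (At : Type) : Type :=
| Atom of At
| Top
| Bot
| And of form At & form At
| Or of form At & form At
| Imp of form At & form At
| FJ of form At.
Arguments Top {At}.
Arguments Bot {At}.

(* The encoding only serves to make formulas a choiceType, so that {fset _} is
   available for the left-hand sides of sequents. *)
Section FormChoice.
Variable At : Type.

Fixpoint tree_of_form (A : form At) : GenTree.tree At :=
  match A with
  | Atom p => GenTree.Leaf p
  | Top => GenTree.Node 0 [::]
  | Bot => GenTree.Node 1 [::]
  | And B C => GenTree.Node 2 [:: tree_of_form B; tree_of_form C]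
  | Or B C => GenTree.Node 3 [:: tree_of_form B; tree_of_form C]
  | Imp B C => GenTree.Node 4 [:: tree_of_form B; tree_of_form C]
  | FJ B => GenTree.Node 5 [:: tree_of_form B]
  end.

Fixpoint form_of_tree (t : GenTree.tree At) : form At :=
  match t with
  | GenTree.Leaf p => Atom p
  | GenTree.Node 0 _ => Top
  | GenTree.Node 2 [:: s; u] => And (form_of_tree s) (form_of_tree u)
  | GenTree.Node 3 [:: s; u] => Or (form_of_tree s) (form_of_tree u)
  | GenTree.Node 4 [:: s; u] => Imp (form_of_tree s) (form_of_tree u)
  | GenTree.Node 5 [:: s] => FJ (form_of_tree s)
  | _ => Bot
  end.

Lemma tree_of_formK : cancel tree_of_form form_of_tree.
Proof. by elim=> //= [A -> B ->|A -> B ->|A -> B ->|A ->]. Qed.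

End FormChoice.

HB.instance Definition _ (At : choiceType) :=
  Choice.copy (form At) (can_type (@tree_of_formK At)).

Record logic : Type :=
  Logic { has_sCoJ : bool; has_CoJ : bool; has_J : bool }.

Definition mJ : logic := Logic false false false.
Definition sCoJ : logic := Logic true false false.
Definition CoJ : logic := Logic false true false.
Definition LJ : logic := Logic false false true.
Definition sI : logic := Logic true false true.
Definition LI : logic := Logic false true true.

Reserved Notation "G |-[ L ] A" (at level 70, no associativity).

(* Contexts are sets: in "A |` G" the formula A may already belong to G.
   Weakening is not a primitive rule. *)
Inductive derivable (At : choiceType) (L : logic) :
    {fset form At} -> form At -> Prop :=
| d_init A : [fset A]%fset |-[L] A
| d_F C A : [fset C]%fset |-[L] A -> [fset FJ C]%fset |-[L] FJ A
| d_cut G0 G1 A B :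
    G0 |-[L] A -> (A |` G1)%fset |-[L] B -> (G0 `|` G1)%fset |-[L] B
| d_top G : G |-[L] Top
| d_bot G A : G |-[L] Bot -> G |-[L] A
| d_orE G0 G1 A B C :
    (A |` G0)%fset |-[L] C -> (B |` G1)%fset |-[L] C ->
    (Or A B |` (G0 `|` G1))%fset |-[L] C
| d_orI0 G A0 A1 : G |-[L] A0 -> G |-[L] Or A0 A1
| d_orI1 G A0 A1 : G |-[L] A1 -> G |-[L] Or A0 A1
| d_andE0 G A0 A1 : G |-[L] And A0 A1 -> G |-[L] A0
| d_andE1 G A0 A1 : G |-[L] And A0 A1 -> G |-[L] A1
| d_andI G0 G1 A B :
    G0 |-[L] A -> G1 |-[L] B -> (G0 `|` G1)%fset |-[L] And A B
| d_impE G0 G1 A B :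
    G0 |-[L] A -> G1 |-[L] FJ (Imp A B) -> (G0 `|` G1)%fset |-[L] B
| d_impI C A B : [fset FJ C; A]%fset |-[L] B -> [fset C]%fset |-[L] Imp A B
| d_sCoJ A :
    has_sCoJ L -> [fset FJ A]%fset |-[L] Bot -> [fset A]%fset |-[L] Bot
| d_CoJ G A : has_CoJ L -> G |-[L] A -> G |-[L] FJ A
| d_J G A : has_J L -> G |-[L] FJ A -> G |-[L] A
where "G |-[ L ] A" := (derivable L G A).

(* Frames, with which locales are identified; nontriviality (\bot != \top) is
   not required. The carrier of an order is a choiceType with a boolean order,
   which under the classical axioms of boolp is no restriction. *)
HB.mixin Record TBLattice_isLocale (d : Order.disp_t) (X : Type)
    of Order.TBLattice d X := {
  bigjoin : set X -> X;
  bigjoin_lub : forall S : set X, isLub S (bigjoin S);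
  meet_bigjoin : forall (a : X) (S : set X),
    a `&` bigjoin S = bigjoin [set (a `&` b)%O | b in S]%classic
}.

#[short(type="localeType")]
HB.structure Definition Locale (d : Order.disp_t) :=
  { X of Order.TBLattice d X & TBLattice_isLocale d X }.

Record modalSpace : Type := ModalSpace {
  ms_disp : Order.disp_t;
  ms_locale :> localeType ms_disp;
  ms_J : ms_locale -> ms_locale;
  ms_J_homo : {homo ms_J : a b / a <= b};
  ms_J_bigjoin : forall S : set ms_locale,
    ms_J (bigjoin S) = bigjoin [set ms_J a | a in S]%classic
}.

Definition impJ (X : modalSpace) (a b : X) : X :=
  bigjoin [set d : X | (ms_J d `&` a <= b)%O]%classic.

Definition MS : set modalSpace := [set: modalSpace]%classic.
Definition sCoTS : set modalSpace :=
  [set X : modalSpace | forall a : X, ms_J a = \bot%O -> a = \bot%O]%classic.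
Definition TS : set modalSpace :=
  [set X : modalSpace | forall a : X, (ms_J a <= a)%O]%classic.
Definition CoTS : set modalSpace :=
  [set X : modalSpace | forall a : X, (a <= ms_J a)%O]%classic.
Definition sS : set modalSpace := (sCoTS `&` TS)%classic.
Definition SS : set modalSpace := (TS `&` CoTS)%classic.

Record is_valuation (At : Type) (X : modalSpace) (V : form At -> X) : Prop := {
  val_top : V Top = \top;
  val_bot : V Bot = \bot;
  val_and : forall A B, V (And A B) = V A `&` V B;
  val_or : forall A B, V (Or A B) = V A `|` V B;
  val_imp : forall A B, V (Imp A B) = impJ (V A) (V B);
  val_J : forall A, V (FJ A) = ms_J (V A)
}.

Definition valid (At : choiceType) (K : set modalSpace)
    (G : {fset form At}) (A : form At) : Prop :=
  forall X : modalSpace, K X ->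
  forall V : form At -> X, is_valuation V ->
  \meet_(B <- G) V B <= V A.

(* Main.v *)
Require Import Defs.
From mathcomp Require Import all_boot all_order finmap.
From mathcomp Require Import classical_sets.
Set Implicit Arguments.
Unset Strict Implicit.
Unset Printing Implicit Defensive.
Import Order.TTheory.
Local Open Scope order_scope.

(** Soundness by induction on derivations, done once for all six logics: each optional rule is
    matched with the condition on [ms_J] that validates it. Two facts carry the proof. Disjunction
    elimination rests on distributivity in the locale, and the rules for [Imp] rest on the
    adjunction between [ms_J _]&[a] and [impJ a _], which holds because [ms_J] preserves joins
    ([le_impJ], [meet_J_impJ]). *)

Lemma le_bigjoin d (X : localeType d) (S : set X) (a : X) :
  S a -> a <= bigjoin S.
Proof. by move=> Sa; have [ub _] := bigjoin_lub S; exact: ub. Qed.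

Lemma bigjoin_le d (X : localeType d) (S : set X) (c : X) :
  (forall a, S a -> a <= c) -> bigjoin S <= c.
Proof. by move=> Sc; have [_ lub] := bigjoin_lub S; exact: lub. Qed.

Lemma meet_bigjoin_le d (X : localeType d) (S : set X) (a c : X) :
  (forall b, S b -> a `&` b <= c) -> a `&` bigjoin S <= c.
Proof.
by move=> Sc; rewrite meet_bigjoin; apply: bigjoin_le => _ [b Sb <-]; exact: Sc.
Qed.

(* The carrier is only known to be a lattice, so binary distributivity has to
   come from the Heyting implication [bigjoin [set b | x `&` b <= c]]. *)
Lemma meet_join_le d (X : localeType d) (x a b c : X) :
  x `&` a <= c -> x `&` b <= c -> x `&` (a `|` b) <= c.
Proof.
move=> ac bc; pose S := [set e : X | (x `&` e <= c)%O]%classic.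
have Sc : x `&` bigjoin S <= c by exact: meet_bigjoin_le.
by apply: le_trans Sc; rewrite leI2 // leUx !le_bigjoin.
Qed.

Lemma le_impJ (X : modalSpace) (a b c : X) :
  ms_J c `&` a <= b -> c <= impJ a b.
Proof. by move=> cab; exact: le_bigjoin. Qed.

(** Modus ponens under [ms_J]: pushing [ms_J] and then the meet with [a] inside the join that
    defines [impJ a b] leaves only elements below [b]. *)
Lemma meet_J_impJ (X : modalSpace) (a b : X) : a `&` ms_J (impJ a b) <= b.
Proof.
rewrite /impJ ms_J_bigjoin; apply: meet_bigjoin_le => _ [c cab <-].
by rewrite meetC.
Qed.

(* The invariant [forall x, (forall B, B \in G -> x <= V B) -> x <= V A] is
   equivalent to [\meet_(B <- G) V B <= V A] but makes the set operations on
   contexts pointwise. *)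
Lemma derivable_sound (At : choiceType) (L : logic) (X : modalSpace)
    (V : form At -> X) (G : {fset form At}) (A : form At) :
  (has_sCoJ L -> sCoTS X) -> (has_CoJ L -> CoTS X) -> (has_J L -> TS X) ->
  is_valuation V -> derivable L G A ->
  forall x : X, (forall B, B \in G -> x <= V B) -> x <= V A.
Proof.
move=> XsCo XCo XT [VT Vb VA VO VI VJ].
elim=> {G A}
  [A|C A _ IH|G0 G1 A B _ IH0 _ IH1|G|G A _ IH|G0 G1 A B C _ IH0 _ IH1
  |G A0 A1 _ IH|G A0 A1 _ IH|G A0 A1 _ IH|G A0 A1 _ IH
  |G0 G1 A B _ IH0 _ IH1|G0 G1 A B _ IH0 _ IH1|C A B _ IH
  |A hL _ IH|G A hL _ IH|G A hL _ IH] x xG.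
- by apply: xG; rewrite inE.
- have xC : x <= V (FJ C) by apply: xG; rewrite inE.
  (* The induction hypothesis is used at [V C] instead of [x]; this works because the context is a
     singleton. *)
  apply: le_trans xC _; rewrite !VJ; apply: ms_J_homo; apply: IH => B.
  by rewrite inE => /eqP ->.
- apply: IH1 => D; rewrite !inE => /orP[/eqP ->|DG].
    by apply: IH0 => E EG; apply: xG; rewrite inE EG.
  by apply: xG; rewrite inE DG orbT.
- by rewrite VT lex1.
- by apply: le_trans (IH x xG) _; rewrite Vb le0x.
- have xO : x <= V A `|` V B by rewrite -VO; apply: xG; rewrite !inE eqxx.
  (* Replacing [x] by its meet with [V A]|[V B] splits the goal into the two cases. *)
  rewrite -(meet_l xO); apply: meet_join_le.
    apply: IH0 => D; rewrite !inE => /orP[/eqP ->|DG]; first exact: leIr.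
    by rewrite leIxl // xG // !inE DG orbT.
  apply: IH1 => D; rewrite !inE => /orP[/eqP ->|DG]; first exact: leIr.
  by rewrite leIxl // xG // !inE DG !orbT.
- by rewrite VO lexUl // IH.
- by rewrite VO lexUr // IH.
- by have := IH x xG; rewrite VA lexI => /andP[].
- by have := IH x xG; rewrite VA lexI => /andP[].
- rewrite VA lexI; apply/andP; split.
    by apply: IH0 => D DG; apply: xG; rewrite inE DG.
  by apply: IH1 => D DG; apply: xG; rewrite inE DG orbT.
- apply: le_trans (meet_J_impJ (V A) (V B)).
  rewrite -VI -VJ lexI; apply/andP; split.
    by apply: IH0 => D DG; apply: xG; rewrite inE DG.
  by apply: IH1 => D DG; apply: xG; rewrite inE DG orbT.
- have xC : x <= V C by apply: xG; rewrite inE.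
  (* Here the hypothesis is instantiated at [ms_J (V C)]&[V A]. *)
  apply: le_trans xC _; rewrite VI; apply: le_impJ; apply: IH => D.
  by rewrite !inE => /orP[] /eqP ->; rewrite ?VJ ?leIl ?leIr.
- have xA : x <= V A by apply: xG; rewrite inE.
  suff VA0 : V A = \bot by rewrite Vb -VA0.
  apply: (XsCo hL); apply/eqP; rewrite -lex0 -Vb -VJ; apply: IH => B.
  by rewrite inE => /eqP ->.
- by rewrite VJ; apply: le_trans (IH x xG) _; exact: XCo.
- by apply: le_trans (IH x xG) _; rewrite VJ; exact: XT.
Qed.

(** The invariant is instantiated at the meet of the context; the flags of [L] become inclusions of
    [K]. *)
Lemma derivable_valid (At : choiceType) (L : logic) (K : set modalSpace)
    (G : {fset form At}) (A : form At) :
  (has_sCoJ L -> (K `<=` sCoTS)%classic) ->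
  (has_CoJ L -> (K `<=` CoTS)%classic) ->
  (has_J L -> (K `<=` TS)%classic) ->
  derivable L G A -> valid K G A.
Proof.
move=> KsCo KCo KT GA X KX V VV.
apply: (derivable_sound _ _ _ VV GA) => [/KsCo|/KCo|/KT|B BG]; try exact.
exact: meets_inf_seq.
Qed.

Theorem theorem5p2 (At : choiceType) (Gamma : {fset form At}) (A : form At) :
  (derivable mJ Gamma A -> valid MS Gamma A) /\
  (derivable sCoJ Gamma A -> valid sCoTS Gamma A) /\
  (derivable CoJ Gamma A -> valid CoTS Gamma A) /\
  (derivable LJ Gamma A -> valid TS Gamma A) /\
  (derivable sI Gamma A -> valid sS Gamma A) /\
  (derivable LI Gamma A -> valid SS Gamma A).
Proof.
by do !split; apply: derivable_valid => // _ X // [].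
Qed.
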